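(* Let $G$ be a locally compact group with a local right action on a locally compact space $X$, defined on the open set $\Gamma\subseteq X\times G$. Let $f\in C_c(X)$. Then $e\in V_f$ and $e\cdot f=f$. Moreover, let $p\in V_f$ and put $g=p\cdot f$. For $q\in G$ we have $q\in V_g$ if and only if $qp\in V_f$, and in that case $(qp)\cdot f=q\cdot g$.
   Context: Locally compact groups and spaces are Hausdorff. $e$ is the identity of $G$. $C_c(X)$ is the space of continuous complex functions on $X$ with compact support; the support is the closure of the set where the function is non-zero. Local right action of $G$ on $X$: a continuous map $(x,p)\mapsto x\cdot p$ from an open subset $\Gamma\subseteq X\times G$ to $X$ such that (i) $(x,e)\in\Gamma$ and $x\cdot e=x$ for all $x\in X$; (ii) for $(x,p)\in\Gamma$ and $q\in G$: $(x,pq)\in\Gamma$ if and only if $(x\cdot p,q)\in\Gamma$, and in that case $x\cdot(pq)=(x\cdot p)\cdot q$. For $f\in C_c(X)$ and $p\in G$ define $(p\cdot f)(x)=f(x\cdot p)$ if $(x,p)\in\Gamma$ and $(p\cdot f)(x)=0$ otherwise. Let $V_f=\{p\in G\mid (x,p^{-1})\in\Gamma\text{ for all }x\text{ in the support of }f\}$. For $p\in V_f$ one has $p\cdot f\in C_c(X)$, so $V_{p\cdot f}$ is defined. *)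

(* Defs.v *)
From HB Require Import structures.
From mathcomp Require Import all_boot all_order all_algebra.
From mathcomp Require Import complex.
From mathcomp Require Import all_classical all_reals all_analysis.
Set Implicit Arguments.
Unset Strict Implicit.
Unset Printing Implicit Defensive.
Import Order.TTheory GRing.Theory Num.Theory.
Import numFieldNormedType.Exports.
Local Open Scope classical_set_scope.
Local Open Scope ring_scope.

HB.mixin Record Group_isTopologicalGroup G & Group G & Topological G := {
  mulg_continuous : continuous (fun x : G * G => (x.1 * x.2)%g) ;
  invg_continuous : continuous (fun x : G => (x^-1)%g)
}.

#[short(type="topologicalGroupType")]
HB.structure Definition TopologicalGroup :=
  {G of Group G & Topological G & Group_isTopologicalGroup G}.

(* The partial map Gamma -> X is represented by a total function on X * G of
   which only the restriction to Gamma = [local_act_dom] is meaningful: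
   [{within _, continuous _}] is continuity for the subspace topology, and no
   axiom constrains the values outside Gamma. *)
Record local_right_action (X : topologicalType) (G : topologicalGroupType) := {
  local_act_dom : set (X * G) ;
  local_act_fun : X * G -> X ;
  local_act_dom_open : open local_act_dom ;
  local_act_continuous : {within local_act_dom, continuous local_act_fun} ;
  local_act_dom1 : forall x, local_act_dom (x, 1%g) ;
  local_act1 : forall x, local_act_fun (x, 1%g) = x ;
  local_act_domM : forall x p q, local_act_dom (x, p) ->
    (local_act_dom (x, (p * q)%g) <-> local_act_dom (local_act_fun (x, p), q)) ;
  local_actM : forall x p q, local_act_dom (x, p) ->
    local_act_dom (x, (p * q)%g) ->
    local_act_fun (x, (p * q)%g) = local_act_fun (local_act_fun (x, p), q)
}.

(* [R[i]^o] is the complex field with the topology given by its modulus. *)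
Definition closed_support (R : realType) (X : topologicalType)
    (f : X -> R[i]^o) : set X :=
  closure [set x | f x != 0].

Definition Cc (R : realType) (X : topologicalType) : set (X -> R[i]^o) :=
  [set f | continuous f /\ compact (closed_support f)].

(* [act_on_fun] and [Vset] are defined for arbitrary functions, so that
   [Vset a (act_on_fun a p f)] makes sense without carrying a proof that
   [act_on_fun a p f] is in [Cc] (which holds when [f] is in [Cc], [p] is in
   [Vset a f] and X is Hausdorff). *)
Section ActionOnFunctions.
Context (R : realType) (X : topologicalType) (G : topologicalGroupType).
Variable a : local_right_action X G.

Definition act_on_fun (p : G) (f : X -> R[i]^o) : X -> R[i]^o :=
  fun x => if `[< local_act_dom a (x, p) >] then f (local_act_fun a (x, p))
           else 0.

Definition Vset (f : X -> R[i]^o) : set G :=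
  [set p | forall x, closed_support f x -> local_act_dom a (x, (p^-1)%g)].

End ActionOnFunctions.

(* Main.v *)
Require Import Defs.
From HB Require Import structures.
From mathcomp Require Import all_boot all_order all_algebra.
From mathcomp Require Import complex.
From mathcomp Require Import all_classical all_reals all_analysis.
Import numFieldNormedType.Exports.
Local Open Scope classical_set_scope.
Local Open Scope ring_scope.

(** Write [S] for the support of [f], [U] for the set where [f] is non-zero,
    and [S.p^-1], [U.p^-1] for their images under [x |-> x.p^-1], which is
    defined on [S] when [p] is in [V_f].  Everything rests on the identity
    [supp (p.f) = S.p^-1] ([closed_support_act]).  Axiom (ii) makes [p] and
    [p^-1] act as mutually inverse partial bijections ([act_domV], [actVK]),
    so [p.f] is non-zero exactly on [U.p^-1]; its closure contains [S.p^-1] by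
    continuity, and is contained in it because [S.p^-1] is compact, hence
    closed in the Hausdorff space [X].

    Thus [q] is in [V_(p.f)] iff [(y.p^-1).q^-1] is defined for all [y] in [S],
    which by (ii) says that [y.(qp)^-1] is.  As for the functions, [(qp).f] and
    [q.(p.f)] clearly agree at [x] when [x.q] is defined.  Otherwise the second
    vanishes at [x], and so does the first: were [y = x.(qp)] defined with
    [f y] non-zero, then [y.p^-1] would be in the support of [p.f], and
    [x = (y.p^-1).q^-1] could be moved back by [q]. *)

Section LocalAction.
Context {X : topologicalType} {G : topologicalGroupType}.
Variable a : local_right_action X G.

Lemma act_domV {x : X} {p : G} : local_act_dom a (x, p) ->
  local_act_dom a (local_act_fun a (x, p), p^-1%g).
Proof.
by move=> xp; apply/(local_act_domM p^-1%g xp); rewrite mulgV; exact: local_act_dom1.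
Qed.

Lemma actVK {x : X} {p : G} : local_act_dom a (x, p) ->
  local_act_fun a (local_act_fun a (x, p), p^-1%g) = x.
Proof.
move=> xp; rewrite -(local_actM xp) mulgV ?local_act1 //.
exact: local_act_dom1.
Qed.

(** Since the domain is open, continuity for its subspace topology is
    continuity at each of its points as points of [X * G]. *)
Lemma act_continuous_at {x : X} {p : G} : local_act_dom a (x, p) ->
  {for x, continuous (fun y => local_act_fun a (y, p))}.
Proof.
move=> xp.
have /(_ (x, p)) actc : {in local_act_dom a, continuous (local_act_fun a)}.
  by rewrite -continuous_open_subspace; [exact: local_act_continuous
                                        |exact: local_act_dom_open].
apply: (@continuous_comp _ _ _ (fun y : X => (y, p)) (local_act_fun a)).
  by apply: cvg_pair; [exact: cvg_id|exact: cvg_cst].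
by apply: actc; rewrite inE.
Qed.

End LocalAction.

Lemma image_closure_sub {X Y : topologicalType} (h : X -> Y) (U : set X) :
  (forall x, closure U x -> {for x, continuous h}) ->
  h @` closure U `<=` closure (h @` U).
Proof.
move=> hc _ [x Ux <-] B /(hc x Ux) /Ux[z [Uz Bz]].
by exists (h z); split => //; exists z.
Qed.

Section ActionOnFunctions.
Context {R : realType} {X : topologicalType} {G : topologicalGroupType}.
Variable a : local_right_action X G.
Implicit Types f : X -> R[i]^o.

Lemma closed_support_neq0 {f} {x : X} : f x != 0 -> closed_support f x.
Proof. by move=> fx; exact: subset_closure. Qed.

Lemma neq0_act f (p : G) : Vset a f p ->
  [set x | act_on_fun a p f x != 0] =
  (fun y => local_act_fun a (y, p^-1%g)) @` [set y | f y != 0].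
Proof.
move=> fp; apply/seteqP; split => x /=.
  rewrite /act_on_fun; case: asboolP => [xp fxp|_]; last by rewrite eqxx.
  by exists (local_act_fun a (x, p)) => //; exact: actVK.
move=> [y fy <-]; have yp := fp _ (closed_support_neq0 fy).
have := act_domV a yp; have := actVK a yp.
by rewrite invgK /act_on_fun => -> /asboolT ->.
Qed.

(** Compactness of the support is what keeps the image from missing limit
    points: a partial homeomorphism need not map closed sets to closed sets. *)
Lemma closed_support_act f (p : G) : hausdorff_space X ->
  compact (closed_support f) -> Vset a f p ->
  closed_support (act_on_fun a p f) =
  (fun y => local_act_fun a (y, p^-1%g)) @` closed_support f.
Proof.
move=> hausX fcompact fp.
have actc x : closed_support f x ->
    {for x, continuous (fun y => local_act_fun a (y, p^-1%g))}.
  by move=> /fp; exact: act_continuous_at.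
rewrite {1}/closed_support neq0_act //; apply/seteqP; split; last first.
  exact: image_closure_sub.
rewrite [X in _ `<=` X](closure_id _).1.
  by apply: closure_subset; apply: image_subset; exact: subset_closure.
apply: compact_closed => //; apply: continuous_compact => //.
by apply: continuous_in_subspaceT => x; rewrite inE; exact: actc.
Qed.

Lemma Vset1 f : Vset a f 1%g.
Proof. by move=> x _; rewrite invg1; exact: local_act_dom1. Qed.

Lemma act_on_fun1 f : act_on_fun a 1%g f = f.
Proof.
apply/funext => x; rewrite /act_on_fun asboolT ?local_act1 //.
exact: local_act_dom1.
Qed.

Lemma Vset_act f (p q : G) : hausdorff_space X ->
  compact (closed_support f) -> Vset a f p ->
  Vset a (act_on_fun a p f) q <-> Vset a f (q * p)%g.
Proof.
move=> hausX fcompact fp; split.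
  rewrite /Vset /= closed_support_act // => gq y fy; rewrite invgM.
  by apply/(local_act_domM _ (fp y fy)); apply: gq; exists y.
rewrite /Vset /= closed_support_act // => fqp _ [y fy <-].
by apply/(local_act_domM _ (fp y fy)); rewrite -invgM; exact: fqp.
Qed.

(** The only point to check is that [(q * p).f] vanishes where [q] does not
    act; this is where [V_(p.f)] enters. *)
Lemma act_on_funM f (p q : G) : hausdorff_space X ->
  compact (closed_support f) -> Vset a f p -> Vset a (act_on_fun a p f) q ->
  act_on_fun a (q * p)%g f = act_on_fun a q (act_on_fun a p f).
Proof.
move=> hausX fcompact fp gq; apply/funext => x.
have [xq|xNq] := pselect (local_act_dom a (x, q)).
  rewrite {2}/act_on_fun (asboolT xq) /act_on_fun.
  rewrite -(asbool_equiv_eq (local_act_domM p xq)).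
  by case: asboolP => // xqp; rewrite (local_actM xq).
rewrite {2}/act_on_fun (asboolF xNq) /act_on_fun.
case: asboolP => // xqp; apply: contrapT => /eqP fy; apply: xNq.
set y := local_act_fun a (x, _) in fy.
have yS : closed_support f y by exact: closed_support_neq0.
have ypq : local_act_dom a (local_act_fun a (y, p^-1%g), q^-1%g).
  by apply: gq; rewrite closed_support_act //; exists y.
have := act_domV a ypq; rewrite invgK -(local_actM (fp y yS)).
  by rewrite -invgM actVK.
exact/(local_act_domM _ (fp y yS)).
Qed.

End ActionOnFunctions.

Theorem proposition2p6 (R : realType)
    (X : topologicalType) (G : topologicalGroupType)
    (hausX : hausdorff_space X) (lcX : locally_compact [set: X])
    (hausG : hausdorff_space G) (lcG : locally_compact [set: G])
    (a : local_right_action X G)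
    (f : X -> R[i]^o) (fCc : Cc f) :
  [/\ Vset a f 1%g,
      act_on_fun a 1%g f = f
    & forall p : G, Vset a f p ->
        let g := act_on_fun a p f in
        forall q : G,
          (Vset a g q <-> Vset a f (q * p)%g) /\
          (Vset a g q -> act_on_fun a (q * p)%g f = act_on_fun a q g)].
Proof.
have [_ fcompact] := fCc.
split; [exact: Vset1|exact: act_on_fun1|move=> p fp g q; split].
  exact: Vset_act.
exact: act_on_funM.
Qed.
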